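(* Let $n\geq 1$ and let $x_1,\ldots,x_n$ be elements of a commutative Banach algebra. Then the smallest polynomially convex circled subset of $\mathbb{C}^n$ containing the joint spectrum $\sigma(x_1,\ldots,x_n)$ is $$\{s\in\mathbb{C}^n:|s_1^{i_1}\cdots s_n^{i_n}|\leq\lVert x_1^{i_1}\cdots x_n^{i_n}\rVert\text{ for all integers } i_1,\ldots,i_n\geq 0\}.$$
   Context: Banach algebras are complex and unital, with submultiplicative norm and $\lVert 1\rVert=1$. For elements $x_1,\ldots,x_n$ of a commutative Banach algebra $A$, the joint spectrum is $\sigma(x_1,\ldots,x_n)=\{(\phi(x_1),\ldots,\phi(x_n)):\phi\in\mathcal{M}_A\}\subset\mathbb{C}^n$, where $\mathcal{M}_A$ is the set of nonzero multiplicative linear functionals $A\to\mathbb{C}$. A compact set $K\subset\mathbb{C}^n$ is polynomially convex if it equals its polynomial hull $\{s\in\mathbb{C}^n:|p(s)|\leq\sup_{K}|p|\text{ for every polynomial }p\}$ (polynomials in the complex coordinates $z_1,\ldots,z_n$). A set $K\subset\mathbb{C}^n$ is circled if $(\alpha_1s_1,\ldots,\alpha_ns_n)\in K$ whenever $s\in K$ and $|\alpha_1|=\cdots=|\alpha_n|=1$. ''Smallest'' means that the set is itself polynomially convex, circled, and contains the joint spectrum, and is contained in every other set with these properties. Convention: $0^0=1$. *)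

(* Defs.v *)
From HB Require Import structures.
From mathcomp Require Import all_boot all_order all_algebra.
From mathcomp Require Import all_classical all_reals all_analysis.
From mathcomp Require Export complex.
(* Required but not imported: the notations of mpoly clash with those of
   mathcomp-analysis. *)
From mathcomp Require mpoly.

Set Implicit Arguments.
Unset Strict Implicit.
Unset Printing Implicit Defensive.

Import Order.TTheory GRing.Theory Num.Theory.
Import numFieldNormedType.Exports.

Local Open Scope classical_set_scope.
Local Open Scope ring_scope.

(* The modulus metric on R[i], which in particular gives 'rV[R[i]]_n the usual
   topology of C^n. *)
HB.instance Definition _ (R : rcfType) := GRing.ComAlgebra.copy R[i] R[i]^o.
HB.instance Definition _ (R : rcfType) := Vector.copy R[i] R[i]^o.
HB.instance Definition _ (R : rcfType) := NormedModule.copy R[i] R[i]^o.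

(* Hierarchy Builder rejects a structure joining a ring and a normed module
   over another field, since [Num.NumDomain] is not below such a join. Hence a
   record whose carrier then receives the ring and algebra instances. *)
Record comBanachAlgType (K : numFieldType) := ComBanachAlg {
  ba_car : completeNormedModType K;
  ba_one : ba_car;
  ba_mul : ba_car -> ba_car -> ba_car;
  ba_mulA : associative ba_mul;
  ba_mulC : commutative ba_mul;
  ba_mul1 : left_id ba_one ba_mul;
  ba_mulDl : left_distributive ba_mul +%R;
  ba_scaleAl : forall k a b, k *: ba_mul a b = ba_mul (k *: a) b;
  ba_norm_mul : forall a b, `|ba_mul a b| <= `|a| * `|b|;
  ba_norm1 : `|ba_one| = 1
}.

Definition ba_sort (K : numFieldType) (A : comBanachAlgType K) : Type :=
  ba_car A.
Coercion ba_sort : comBanachAlgType >-> Sortclass.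

Section ComBanachAlg.
Variables (K : numFieldType) (A : comBanachAlgType K).

HB.instance Definition _ := CompleteNormedModule.copy A (ba_car A).

Lemma ba_one_neq0 : @ba_one K A != 0.
Proof.
by apply/eqP => one0; have := ba_norm1 A; rewrite one0 normr0 => /esym/eqP;
  rewrite oner_eq0.
Qed.

HB.instance Definition _ := GRing.Zmodule_isComNzRing.Build A
  (@ba_mulA K A) (@ba_mulC K A) (@ba_mul1 K A) (@ba_mulDl K A) ba_one_neq0.
HB.instance Definition _ :=
  GRing.Lmodule_isLalgebra.Build K A (@ba_scaleAl K A).
HB.instance Definition _ := GRing.Lalgebra_isComAlgebra.Build K A.

Lemma ba_normrM (a b : A) : `|a * b| <= `|a| * `|b|.
Proof. exact: ba_norm_mul. Qed.

Lemma ba_normr1 : `|1 : A| = 1.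
Proof. exact: ba_norm1. Qed.

End ComBanachAlg.

(* M_A; no continuity is assumed. *)
Definition characters (R : realType) (A : comBanachAlgType R[i]) :
    set (A -> R[i]) :=
  [set phi | [/\ scalar phi, {morph phi : a b / a * b} &
                 exists a, phi a != 0]].

Definition joint_spectrum (R : realType) (A : comBanachAlgType R[i]) (n : nat)
    (x : 'I_n -> A) : set 'rV[R[i]]_n :=
  [set \row_j phi (x j) | phi in @characters R A].

(* `|_| on R[i] is R[i]-valued, and complex.Re takes it back to R. The
   supremum is in \bar R, so that it is correct for every K. *)
Definition polynomial_hull (R : realType) (n : nat) (K : set 'rV[R[i]]_n) :
    set 'rV[R[i]]_n :=
  let absp (p : mpoly.mpoly n R[i]) (s : 'rV[R[i]]_n) : R :=
    complex.Re `|mpoly.meval (s ord0) p| in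
  [set s | forall p : mpoly.mpoly n R[i],
    ((absp p s)%:E <= ereal_sup [set (absp p z)%:E | z in K])%E].

Definition polynomially_convex (R : realType) (n : nat)
    (K : set 'rV[R[i]]_n) : Prop :=
  compact K /\ K = polynomial_hull K.

Definition circled (R : realType) (n : nat) (K : set 'rV[R[i]]_n) : Prop :=
  forall s alpha : 'rV[R[i]]_n, K s -> (forall j, `|alpha ord0 j| = 1) ->
    K (\row_j (alpha ord0 j * s ord0 j)).

(* Stronger than S being [smallest] of classical_sets (an intersection): S must
   itself satisfy P. *)
Definition is_smallest (T : Type) (P : set (set T)) (S : set T) : Prop :=
  P S /\ forall K, P K -> S `<=` K.

(* Main.v *)
Require Import Defs.
From mathcomp Require Import all_boot all_order all_algebra.
From mathcomp Require Import all_classical all_reals all_analysis.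
From mathcomp Require Import cyclic separable cyclotomic ring lra zify.

Set Implicit Arguments.
Unset Strict Implicit.
Unset Printing Implicit Defensive.

Import Order.TTheory GRing.Theory Num.Theory.
Import numFieldNormedType.Exports.
Import (canonicals, coercions) mpoly.

Local Open Scope classical_set_scope.
Local Open Scope ring_scope.

(** Write [S] for the set in the statement and [N] for the norm of [A].

    [S] has the three properties.  It is compact because it is closed and, by
    the inequalities for the coordinates, bounded; it is its own hull because
    monomials are polynomials; it is circled because only the moduli of the
    coordinates matter; it contains the joint spectrum because characters
    contract the norm ([character_le], a consequence of the Neumann series).

    For minimality let [K] be polynomially convex and circled and contain the
    joint spectrum, and let [s] be in [S].  Two estimates are combined.

    The algebraic one: for a monomial [a] in the [x j], with value [c] at [s],
    the powers of [a] are monomials too, so [|c| ^ m <= N (a ^ m)] for all [m],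
    and hence [|c|] is at most the spectral radius of [a].  The latter is the
    modulus of [a] at some character ([exists_character_ge]), so that every
    monomial is at [s] at most as large as at some point of [K].

    The analytic one: on a circled set, averaging a polynomial [p] against
    characters of the torus isolates its coefficients, so every term of [p] is
    bounded on [K] by the bound [B] of [p] on [K] ([cauchy_estimate]).  By the
    algebraic estimate the same holds at [s], so [|p s|] is at most [B] times
    the number of terms of [p].  Applied to [p ^ m], whose number of terms grows
    only polynomially in [m], this gives [|p s| <= B] after extracting roots
    ([le_of_powers]).  So [s] is in the hull of [K], which is [K].

    The existence of characters is obtained without quotients, inverses or
    complex analysis.  Seminorms on [A] that commute with squaring play the
    role of compact sets of characters, and a minimal one, given by Zorn's
    lemma, plays the role of a point: it is multiplicative, because passing
    from [q] to the limit of [q (g f ^ m) / q f ^ m] would otherwise produce a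
    smaller one ([exists_multiplicative_seminorm]).  A multiplicative seminorm
    comes from a character by an elementary version of the Gelfand-Mazur
    theorem ([gelfand_mazur]), which factors polynomials over the complex
    numbers and uses the compactness of discs. *)

(** * Comparing growth rates *)

Lemma bernoulli_le (R : realDomainType) (e : R) (m : nat) :
  0 <= e -> 1 + m%:R * e <= (1 + e) ^+ m.
Proof.
move=> e0; elim: m => [|m IH]; first by rewrite mul0r addr0 expr0.
rewrite exprS -natr1 mulrDl mul1r.
have h : (1 + e) * (1 + m%:R * e) <= (1 + e) * (1 + e) ^+ m.
  by rewrite ler_pM2l // ltr_pwDl.
apply: le_trans h; have m0 : 0 <= (m%:R : R) by [].
by nra.
Qed.

(** Exponential growth beats polynomial growth: this is how the constants and
    the polynomial factors of the estimates for powers are removed. *)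
Lemma le_of_powers (R : realType) (u B C : R) (k : nat) :
  0 <= u -> 0 <= B ->
  (forall m, u ^+ m <= C * (m.+1%:R) ^+ k * B ^+ m) -> u <= B.
Proof.
move=> u0 B0 H; rewrite leNgt; apply/negP => Bu.
have [Bz|Bp] := eqVneq B 0.
  by have := H 1%N; rewrite Bz !expr1 mulr0 leNgt -Bz Bu.
have {}Bp : 0 < B by rewrite lt0r Bp.
(* Taking [k + 1] roots of [u / B] first turns the growth of order [m ^ k.+1]
   that is needed into Bernoulli's linear growth of the powers of [h]. *)
pose h := (u / B) `^ (k.+1%:R^-1).
have q1 : 1 < u / B by rewrite ltr_pdivlMr // mul1r.
have h1 : 1 < h.
  have <- : (1 : R) `^ (k.+1%:R^-1) = 1 by rewrite powR1.
  rewrite /h gt0_ltr_powR ?nnegrE ?invr_gt0 //.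
  by rewrite ltW // (lt_trans ltr01).
have hk : h ^+ k.+1 = u / B.
  rewrite /h -powR_mulrn ?powR_ge0 // -powRrM mulVf ?pnatr_eq0 // powRr1 //.
  by rewrite ltW // (lt_trans ltr01).
pose d := Num.min 1 (h - 1).
have d0 : 0 < d by rewrite lt_min ltr01 subr_gt0.
have key m : d ^+ k.+1 * m.+1%:R <= C.
  have le1 : d * m.+1%:R <= h ^+ m.
    apply: (@le_trans _ _ (1 + m%:R * d)).
      by rewrite -natr1 mulrDr mulr1 mulrC addrC lerD2r /d ge_min lexx.
    apply: (@le_trans _ _ ((1 + d) ^+ m)); first exact/bernoulli_le/ltW.
    have dh : 1 + d <= h by rewrite -lerBrDl /d ge_min lexx orbT.
    by rewrite lerXn2r ?nnegrE ?(ltW (lt_trans ltr01 h1)) // addr_ge0 // ltW.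
  have le2 : (d * m.+1%:R) ^+ k.+1 <= (u / B) ^+ m.
    rewrite -hk exprAC lerXn2r ?nnegrE //.
      by rewrite mulr_ge0 ?ltW.
    by rewrite exprn_ge0 // ltW // (lt_trans ltr01).
  have := H m; rewrite -ler_pdivrMr ?exprn_gt0 // -expr_div_n.
  move/(le_trans le2); rewrite exprMn [_.+1%:R ^+ k.+1]exprS mulrA.
  by rewrite ler_pM2r // exprn_gt0.
have dk0 : 0 < d ^+ k.+1 by rewrite exprn_gt0.
have C0 : 0 <= C / d ^+ k.+1.
  by rewrite divr_ge0 ?ltW // (lt_le_trans _ (key 0%N)) // mulr1.
have := key (Num.bound (C / d ^+ k.+1)).
rewrite mulrC -ler_pdivlMr // leNgt => /negP; apply.
by rewrite -natr1 ltr_wpDr // archi_boundP.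
Qed.

Lemma le_add_of_lt (R : realFieldType) (x y z : R) :
  (forall c d, x < c -> y < d -> z <= c + d) -> z <= x + y.
Proof.
move=> H; rewrite -lerBlDr; apply/unstable.ler_gtP => c xc.
rewrite lerBlDr addrC -lerBlDr; apply/unstable.ler_gtP => d yd.
by rewrite lerBlDr addrC H.
Qed.

(** Together with [le_add_of_lt], this carries inequalities over to infima
    that need not be attained. *)
Lemma le_mul_of_lt (R : realFieldType) (x y z : R) : 0 <= x -> 0 <= y ->
  (forall c d, x < c -> y < d -> z <= c * d) -> z <= x * y.
Proof.
move=> x0 y0 H.
have {}H c : x < c -> z <= c * y.
  move=> xc; have c0 : 0 < c by apply: le_lt_trans xc.
  rewrite mulrC -ler_pdivrMr //; apply/unstable.ler_gtP => d yd.
  by rewrite ler_pdivrMr // mulrC H.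
have [yz|yn0] := eqVneq y 0.
  by have := H (x + 1); rewrite yz !mulr0 ltrDl ltr01 => ->.
have yp : 0 < y by rewrite lt0r yn0.
rewrite -ler_pdivrMr //; apply/unstable.ler_gtP => c xc.
by rewrite ler_pdivrMr // H.
Qed.

(** * The norm with real values *)

Section ModulusReal.
Variable R : realType.

(** Norms over [R[i]] take values in [R[i]], where infima need not exist; they
    are real, so their real parts carry the same information. *)
Definition rnorm (V : normedZmodType R[i]) (v : V) : R := complex.Re `|v|.

Lemma rnormE (V : normedZmodType R[i]) (v : V) :
  `|v| = real_complex R (rnorm v).
Proof. by rewrite /rnorm RRe_real // normr_real. Qed.

Lemma rnorm_le (V W : normedZmodType R[i]) (v : V) (w : W) :
  (`|v| <= `|w|) = (rnorm v <= rnorm w).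
Proof. by rewrite !rnormE lecR. Qed.

Lemma rnorm_ge0 (V : normedZmodType R[i]) (v : V) : 0 <= rnorm v.
Proof. by rewrite -ler0c -rnormE. Qed.

Lemma rnormD (V : normedZmodType R[i]) (v w : V) :
  rnorm (v + w) <= rnorm v + rnorm w.
Proof. by rewrite -lecR rmorphD /= -!rnormE ler_normD. Qed.

Lemma rnormN (V : normedZmodType R[i]) (v : V) : rnorm (- v) = rnorm v.
Proof. by rewrite /rnorm normrN. Qed.

Lemma rnorm0 (V : normedZmodType R[i]) : rnorm (0 : V) = 0.
Proof. by rewrite /rnorm normr0. Qed.

Lemma rnorm_eq0 (V : normedZmodType R[i]) (v : V) : rnorm v = 0 -> v = 0.
Proof. by move=> v0; apply: normr0_eq0; rewrite rnormE v0. Qed.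

Lemma rnorm1 : rnorm (1 : R[i]) = 1.
Proof. by rewrite /rnorm normr1. Qed.

Lemma rnormM (a b : R[i]) : rnorm (a * b) = rnorm a * rnorm b.
Proof. by apply: (@complexI R); rewrite rmorphM /= -!rnormE normrM. Qed.

Lemma rnormX (a : R[i]) m : rnorm (a ^+ m) = rnorm a ^+ m.
Proof. by apply: (@complexI R); rewrite rmorphXn /= -!rnormE normrX. Qed.

Lemma rnormV (a : R[i]) : rnorm a^-1 = (rnorm a)^-1.
Proof. by apply: (@complexI R); rewrite fmorphV /= -!rnormE normfV. Qed.

Lemma rnorm_real (r : R) : 0 <= r -> rnorm (real_complex R r) = r.
Proof.
by move=> r0; apply: (@complexI R); rewrite -rnormE ger0_norm // ler0c.
Qed.

Lemma rnormZ (V : normedModType R[i]) (a : R[i]) (v : V) :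
  rnorm (a *: v) = rnorm a * rnorm v.
Proof. by apply: (@complexI R); rewrite rmorphM /= -!rnormE normrZ. Qed.

Lemma rnorm_sum (V : normedZmodType R[i]) (I : Type) (r : seq I) (P : pred I)
    (F : I -> V) :
  rnorm (\sum_(i <- r | P i) F i) <= \sum_(i <- r | P i) rnorm (F i).
Proof.
elim/big_rec2: _ => [|i y z _ IH]; first by rewrite rnorm0.
by apply: le_trans (rnormD _ _) _; rewrite lerD2l.
Qed.

End ModulusReal.

(** * Uniform seminorms *)

Section UniformSeminorms.
Variables (R : realType) (A : comAlgType R[i]).

(** The model to keep in mind is the supremum of the modulus over a nonempty
    compact set of characters. *)
Record uniform_seminorm (q : A -> R) : Prop := UniformSeminorm {
  usn1 : q 1 = 1;
  usnD : forall f g, q (f + g) <= q f + q g;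
  usnZ : forall k f, q (k *: f) = rnorm k * q f;
  usnM : forall f g, q (f * g) <= q f * q g;
  usnX2 : forall f, q (f ^+ 2) = q f ^+ 2 }.

Section Basics.
Variables (q : A -> R) (qU : uniform_seminorm q).

Lemma usn0 : q 0 = 0.
Proof. by rewrite -(scale0r 0) (usnZ qU) rnorm0 mul0r. Qed.

Lemma usnN f : q (- f) = q f.
Proof. by rewrite -scaleN1r (usnZ qU) rnormN rnorm1 mul1r. Qed.

Lemma usn_ge0 f : 0 <= q f.
Proof. by have := usnD qU f (- f); rewrite subrr usn0 usnN; lra. Qed.

(** Iterating the hypothesis on squares gives the powers of exponent [2 ^ m];
    the other exponents follow by comparing [f ^+ m] with a larger such
    power. *)
Lemma usnX f m : q (f ^+ m) = q f ^+ m.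
Proof.
have Xle k : q (f ^+ k) <= q f ^+ k.
  elim: k => [|k IH]; first by rewrite !expr0 (usn1 qU).
  rewrite !exprS; apply: le_trans (usnM qU _ _) _.
  by rewrite ler_wpM2l // usn_ge0.
apply/eqP; rewrite eq_le Xle /=.
have [f0|fn0] := eqVneq (q f) 0.
  case: m => [|m]; first by rewrite !expr0 (usn1 qU).
  by rewrite f0 expr0n /= usn_ge0.
have fp : 0 < q f by rewrite lt0r fn0 usn_ge0.
have X2 k : q (f ^+ (2 ^ k)) = q f ^+ (2 ^ k).
  by elim: k => [|k IH]; rewrite ?expr1 // expnSr !exprM (usnX2 qU) IH.
have mle : (m <= 2 ^ m)%N by rewrite ltnW // ltn_expl.
rewrite -(@ler_pM2r _ (q f ^+ (2 ^ m - m))) ?exprn_gt0 //.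
rewrite -exprD subnKC // -X2 -{1}(subnKC mle) exprD.
apply: le_trans (usnM qU _ _) _.
by rewrite ler_wpM2l ?usn_ge0.
Qed.

Section Localization.
Variables (f : A) (f_gt0 : 0 < q f).

Let u (g : A) (m : nat) : R := q (g * f ^+ m) / q f ^+ m.

(** When [q] is the supremum over a set of characters, this is the supremum
    over those characters at which the modulus of [f] is maximal.  The sequence
    is nonincreasing, so its infimum is also its limit. *)
Definition localized_seminorm (g : A) : R := inf (range (u g)).

Let fm0 m : 0 < q f ^+ m. Proof. by rewrite exprn_gt0. Qed.

Let u_ge0 g m : 0 <= u g m.
Proof. by rewrite divr_ge0 ?usn_ge0 // ltW. Qed.

Let u_dec g : {homo u g : n m / (n <= m)%N >-> m <= n}.
Proof.
move=> a b ab; rewrite /u ler_pdivrMr // -(subnKC ab).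
rewrite !exprD !mulrA divfK ?gt_eqF //.
by rewrite -(usnX f (b - a)%N) (usnM qU).
Qed.

Let u_lb g : has_lbound (range (u g)).
Proof. by exists 0 => _ [m _ <-]. Qed.

Let loc_cvg g : u g m @[m --> \oo] --> localized_seminorm g.
Proof. exact: nonincreasing_cvgn. Qed.

Let loc_le g m : localized_seminorm g <= u g m.
Proof. by apply: ge_inf => //; exists m. Qed.

Let le_loc g c : (forall m, c <= u g m) -> c <= localized_seminorm g.
Proof.
move=> H; apply: lb_le_inf; first by exists (u g 0%N), 0%N.
by move=> _ [m _ <-].
Qed.

Lemma localized_le g : localized_seminorm g <= q g.
Proof. by apply: le_trans (loc_le g 0) _; rewrite /u !expr0 mulr1 divr1. Qed.

(** Multiplication by [f] only shifts the index in the defining sequence. *)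
Lemma localizedM_ge g :
  q f * localized_seminorm g <= localized_seminorm (f * g).
Proof.
apply: le_loc => m; apply: (@le_trans _ _ (q f * u g m.+1)).
  by rewrite ler_pM2l.
rewrite /u [q f ^+ m.+1]exprS invfM mulrCA mulVKf ?gt_eqF //.
by rewrite exprS mulrA [g * f]mulrC.
Qed.

(** Passing to the localization at [f] does not lose the lower bound on the
    multiplication by another element [a]; this keeps the class that Zorn's
    lemma is applied to stable under localization. *)
Lemma localized_ge_mul a r : 0 <= r -> (forall g, r * q g <= q (a * g)) ->
  forall g, r * localized_seminorm g <= localized_seminorm (a * g).
Proof.
move=> r0 H g; apply: le_loc => m; apply: (@le_trans _ _ (r * u g m)).
  by rewrite ler_wpM2l.
by rewrite /u mulrA ler_pM2r ?invr_gt0 // -mulrA.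
Qed.

Let cvg_le (c l : R) (v : nat -> R) :
  v m @[m --> \oo] --> l -> (forall m, c <= v m) -> c <= l.
Proof.
move=> vl H; rewrite -(cvg_lim (@Rhausdorff R) vl).
by apply: limr_ge; [apply/cvg_ex; exists l|apply: nearW].
Qed.

(** Each property passes to the limit; for products and squares, the terms of
    index [m + m] for the product are compared with those of index [m] for the
    factors. *)
Lemma localized_uniform : uniform_seminorm localized_seminorm.
Proof.
split.
- have u1 m : u 1 m = 1 by rewrite /u mul1r usnX divff // gt_eqF.
  apply/eqP; rewrite eq_le -{1}(u1 0%N) loc_le /=.
  by apply: le_loc => m; rewrite u1.
- move=> g h; apply: (cvg_le (v := fun m => u g m + u h m)) => [|m].
    by apply: cvgD; exact: loc_cvg.
  apply: le_trans (loc_le _ m) _.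
  by rewrite /= /u -mulrDl ler_pM2r ?invr_gt0 // mulrDl (usnD qU).
- move=> k g; rewrite -(cvg_lim (@Rhausdorff R) (@loc_cvg (k *: g))).
  apply: cvg_lim; first exact: Rhausdorff.
  rewrite (_ : u (k *: g) = (fun m => rnorm k * u g m)); last first.
    by apply/funext => m; rewrite /u -scalerAl (usnZ qU) mulrA.
  apply: cvgMr; exact: loc_cvg.
- move=> g h; apply: (cvg_le (v := fun m => u g m * u h m)) => [|m].
    by apply: cvgM; exact: loc_cvg.
  apply: le_trans (loc_le _ (m + m)%N) _.
  rewrite /= /u !exprD [leRHS]mulrACA -invfM ler_pM2r ?invr_gt0 ?mulr_gt0 //.
  by rewrite mulrACA (usnM qU).
- have u2 g m : u (g ^+ 2) (m * 2) = u g m ^+ 2.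
    by rewrite /u !exprM -exprMn (usnX2 qU) expr_div_n.
  move=> g; apply/eqP; rewrite eq_le; apply/andP; split.
    rewrite [leRHS]expr2; apply: (cvg_le (v := fun m => u g m * u g m)) => [|m].
      by apply: cvgM; exact: loc_cvg.
    by rewrite /= -expr2 -u2.
  apply: le_loc => m; apply: (@le_trans _ _ (u (g ^+ 2) (m * 2))).
    rewrite u2 lerXn2r ?nnegrE //; first exact: le_loc.
  by apply: u_dec; rewrite leq_pmulr.
Qed.

End Localization.
End Basics.

(** In a chain, strict upper bounds of the infimum at two elements of [A] are
    witnessed by a single member, so that inequalities that involve two elements
    pass to the infimum. *)
Lemma chain_inf_uniform (F : set (A -> R)) : F !=set0 ->
  (forall q, F q -> uniform_seminorm q) ->
  (forall p q, F p -> F q ->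
    (forall g, p g <= q g) \/ (forall g, q g <= p g)) ->
  uniform_seminorm (fun g => inf [set q g | q in F]).
Proof.
move=> [q0 Fq0] FU Ftot; set I := fun g => _.
have I_le q g : F q -> I g <= q g.
  move=> Fq; apply: ge_inf; last by exists q.
  by exists 0 => _ [p Fp <-]; exact/usn_ge0/FU.
have le_I c g : (forall q, F q -> c <= q g) -> c <= I g.
  move=> H; apply: lb_le_inf; first by exists (q0 g), q0.
  by move=> _ [q Fq <-]; exact: H.
have I_ge0 g : 0 <= I g by apply: le_I => q Fq; exact/usn_ge0/FU.
have I_lt c g : I g < c -> exists2 q, F q & q g < c.
  move=> Ic; apply: contrapT => H; move: Ic; rewrite ltNge => /negP; apply.
  by apply: le_I => q Fq; rewrite leNgt; apply/negP => qc; apply: H; exists q.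
have two g h c d : I g < c -> I h < d -> exists q, [/\ F q, q g < c & q h < d].
  move=> /I_lt[p Fp pc] /I_lt[q Fq qd].
  have [pq|qp] := Ftot _ _ Fp Fq.
    by exists p; split=> //; apply: le_lt_trans (pq h) qd.
  by exists q; split=> //; apply: le_lt_trans (qp g) pc.
split.
- apply/eqP; rewrite eq_le; apply/andP; split.
    by rewrite -(usn1 (FU _ Fq0)) I_le.
  by apply: le_I => q Fq; rewrite (usn1 (FU _ Fq)).
- move=> f g; apply: le_add_of_lt => c d cf dg.
  have [q [Fq qf qg]] := two f g c d cf dg.
  apply: le_trans (I_le _ _ Fq) _; apply: le_trans (usnD (FU _ Fq) _ _) _.
  by rewrite lerD // ltW.
- move=> k g; have [->|k0] := eqVneq k 0.
    rewrite rnorm0 mul0r; apply/eqP; rewrite eq_le I_ge0 andbT.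
    by rewrite scale0r -(usn0 (FU _ Fq0)) I_le.
  have kp : 0 < rnorm k.
    rewrite lt0r rnorm_ge0 andbT; apply: contra_neq k0; exact: rnorm_eq0.
  apply/eqP; rewrite eq_le; apply/andP; split.
    rewrite mulrC -ler_pdivrMr //; apply: le_I => q Fq.
    by rewrite ler_pdivrMr // mulrC -(usnZ (FU _ Fq)) I_le.
  apply: le_I => q Fq; rewrite (usnZ (FU _ Fq)) ler_pM2l //.
  exact: I_le.
- move=> f g; apply: le_mul_of_lt => // c d cf dg.
  have [q [Fq qf qg]] := two f g c d cf dg.
  apply: le_trans (I_le _ _ Fq) _; apply: le_trans (usnM (FU _ Fq) _ _) _.
  by rewrite ler_pM ?(usn_ge0 (FU _ Fq)) // ltW.
- move=> f; apply/eqP; rewrite eq_le; apply/andP; split; last first.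
    apply: le_I => q Fq; rewrite (usnX2 (FU _ Fq)).
    by rewrite lerXn2r ?nnegrE ?(usn_ge0 (FU _ Fq)) ?I_le.
  rewrite -[leLHS]sqr_sqrtr // lerXn2r ?nnegrE ?sqrtr_ge0 //.
  apply: le_I => q Fq; have qf0 := usn_ge0 (FU _ Fq) f.
  rewrite -[leRHS]ger0_norm // -sqrtr_sqr ler_wsqrtr //.
  by rewrite -(usnX2 (FU _ Fq)) I_le.
Qed.

End UniformSeminorms.

(** * The spectral seminorm *)

Section SpectralSeminorm.
Variables (R : realType) (A : comAlgType R[i]) (N : A -> R).
Hypothesis N1 : N 1 = 1.
Hypothesis ND : forall f g, N (f + g) <= N f + N g.
Hypothesis NZ : forall k f, N (k *: f) = rnorm k * N f.
Hypothesis NM : forall f g, N (f * g) <= N f * N g.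

(** The constant [C] reduces the subadditivity of the spectral radius to the
    binomial formula, with no limit to compute.  Rates are positive in order to
    be invertible. *)
Definition growth_rate (f : A) : set R :=
  [set a | 0 < a /\ exists2 C, 0 <= C & forall m, N (f ^+ m) <= C * a ^+ m].

(** The spectral radius: the infimum of the rates of growth of [N (f ^+ m)] is
    the limit of their [m]-th roots. *)
Definition spectral_seminorm (f : A) : R := inf (growth_rate f).

Let N0 : N 0 = 0.
Proof. by rewrite -(scale0r 0) NZ rnorm0 mul0r. Qed.

Let N_ge0 f : 0 <= N f.
Proof.
have := ND f (- f); rewrite subrr N0.
by have -> : N (- f) = N f; [rewrite -scaleN1r NZ rnormN rnorm1 mul1r|lra].
Qed.

Let NX f m : N (f ^+ m) <= N f ^+ m.
Proof.
elim: m => [|m IH]; first by rewrite !expr0 N1.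
by rewrite !exprS; apply: le_trans (NM _ _) _; rewrite ler_wpM2l.
Qed.

Let N_sum (I : Type) (r : seq I) (F : I -> A) :
  N (\sum_(i <- r) F i) <= \sum_(i <- r) N (F i).
Proof.
elim/big_rec2: _ => [|i y z _ IH]; first by rewrite N0.
by apply: le_trans (ND _ _) _; rewrite lerD2l.
Qed.

Let NMn f m : N (f *+ m) <= N f *+ m.
Proof.
elim: m => [|m IH]; first by rewrite !mulr0n N0.
by rewrite !mulrS; apply: le_trans (ND _ _) _; rewrite lerD2l.
Qed.

Let rate_gt f a : N f < a -> growth_rate f a.
Proof.
move=> fa; split; first exact: le_lt_trans (N_ge0 f) fa.
exists 1 => // m; rewrite mul1r; apply: le_trans (NX _ _) _.
by rewrite lerXn2r ?nnegrE ?N_ge0 ?ltW // (le_lt_trans (N_ge0 f) fa).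
Qed.

Let spec_le f a : growth_rate f a -> spectral_seminorm f <= a.
Proof. by apply: ge_inf; exists 0 => b [/ltW]. Qed.

Let le_spec f c :
  (forall a, growth_rate f a -> c <= a) -> c <= spectral_seminorm f.
Proof.
move=> H; apply: lb_le_inf; last exact: H.
by exists (N f + 1); apply: rate_gt; rewrite ltrDl.
Qed.

Let spec_ge0 f : 0 <= spectral_seminorm f.
Proof. by apply: le_spec => a [/ltW]. Qed.

Let spec_lt f c : spectral_seminorm f < c -> exists2 a, growth_rate f a & a < c.
Proof.
move=> fc; apply: contrapT => H; move: fc; rewrite ltNge => /negP; apply.
by apply: le_spec => a fa; rewrite leNgt; apply/negP => ac; apply: H; exists a.
Qed.

Let rateD f g a b :
  growth_rate f a -> growth_rate g b -> growth_rate (f + g) (a + b).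
Proof.
move=> [a0 [C C0 fC]] [b0 [D D0 gD]]; split; first exact: addr_gt0.
exists (C * D) => [|m]; first exact: mulr_ge0.
rewrite !exprDn mulr_sumr; apply: le_trans (N_sum _ _) _.
apply: ler_sum => i _; apply: le_trans (NMn _ _) _.
rewrite mulrnAr lerMn2r; apply/orP; right.
apply: le_trans (NM _ _) _; rewrite mulrACA.
by rewrite ler_pM.
Qed.

Let rateM f g a b :
  growth_rate f a -> growth_rate g b -> growth_rate (f * g) (a * b).
Proof.
move=> [a0 [C C0 fC]] [b0 [D D0 gD]]; split; first exact: mulr_gt0.
exists (C * D) => [|m]; first exact: mulr_ge0.
rewrite !exprMn; apply: le_trans (NM _ _) _; rewrite mulrACA.
by rewrite ler_pM.
Qed.

Let rateZ k f a :
  k != 0 -> growth_rate f a -> growth_rate (k *: f) (rnorm k * a).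
Proof.
move=> k0 [a0 [C C0 fC]]; split.
  rewrite mulr_gt0 // lt0r rnorm_ge0 andbT.
  by apply: contra_neq k0; exact: rnorm_eq0.
exists C => // m; rewrite exprZn NZ rnormX exprMn mulrCA.
by rewrite ler_wpM2l // exprn_ge0 // rnorm_ge0.
Qed.

(** Even powers of [f] are powers of [f ^+ 2]; odd powers cost a factor [N f],
    which goes into the constant. *)
Let rate_sqrt f a : growth_rate (f ^+ 2) a -> growth_rate f (Num.sqrt a).
Proof.
move=> [a0 [C C0 fC]]; set s := Num.sqrt a.
have s0 : 0 < s by rewrite sqrtr_gt0.
have sa : a = s ^+ 2 by rewrite sqr_sqrtr // ltW.
split=> //; exists (C + N f * C / s) => [|m].
  by rewrite addr_ge0 // !mulr_ge0 // invr_ge0 ltW.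
have pm k : 0 <= s ^+ k by rewrite exprn_ge0 // ltW.
have even k : N (f ^+ (2 * k)) <= C * s ^+ (2 * k).
  by rewrite !exprM -sa.
rewrite -(odd_double_half m) -mul2n; case: (odd m) => /=; last first.
  rewrite add0n mulrDl; apply: le_trans (even _) _; rewrite lerDl.
  by rewrite !mulr_ge0 // invr_ge0 ltW.
rewrite add1n !exprS mulrDl; apply: le_trans (NM _ _) _.
apply: (@le_trans _ _ (N f * C / s * (s * s ^+ (2 * m./2)))); last first.
  by rewrite lerDr !mulr_ge0 // ltW.
by rewrite mulrA divfK ?gt_eqF // -mulrA ler_wpM2l.
Qed.

Lemma spectral_seminorm_le f : spectral_seminorm f <= N f.
Proof. by apply/unstable.ler_gtP => c fc; apply/spec_le/rate_gt. Qed.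

Lemma spectral_seminorm_ge f (r : R) : 0 <= r ->
  (forall m, r ^+ m <= N (f ^+ m)) -> r <= spectral_seminorm f.
Proof.
move=> r0 H; apply: le_spec => a [a0 [C C0 fC]].
apply: (@le_of_powers _ _ _ C 0) => // [|m]; first exact: ltW.
by rewrite expr0 mulr1; apply: le_trans (H m) (fC m).
Qed.

Lemma spectral_uniform : uniform_seminorm spectral_seminorm.
Proof.
split.
- apply/eqP; rewrite eq_le -{1}N1 spectral_seminorm_le /=.
  by apply: spectral_seminorm_ge => // m; rewrite !expr1n N1.
- move=> f g; apply: le_add_of_lt => c d /spec_lt[a fa ac] /spec_lt[b gb bd].
  by apply: le_trans (spec_le (rateD fa gb)) _; rewrite lerD // ltW.
- move=> k f; have [->|k0] := eqVneq k 0.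
    rewrite rnorm0 mul0r; apply/eqP; rewrite eq_le spec_ge0 andbT.
    by rewrite -N0 scale0r spectral_seminorm_le.
  have kp : 0 < rnorm k.
    by rewrite lt0r rnorm_ge0 andbT; apply: contra_neq k0; exact: rnorm_eq0.
  apply/eqP; rewrite eq_le; apply/andP; split.
    rewrite mulrC -ler_pdivrMr //; apply: le_spec => a fa.
    by rewrite ler_pdivrMr // mulrC; apply/spec_le/rateZ.
  apply: le_spec => a fa; rewrite -ler_pdivlMl //.
  have ki : k^-1 != 0 by rewrite invr_eq0.
  have := spec_le (rateZ ki fa).
  by rewrite scalerA mulVf // scale1r rnormV.
- move=> f g; apply: le_mul_of_lt => // c d /spec_lt[a fa ac] /spec_lt[b gb bd].
  apply: le_trans (spec_le (rateM fa gb)) _.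
  by rewrite ler_pM ?ltW //; [case: fa|case: gb].
- move=> f; apply/eqP; rewrite eq_le; apply/andP; split.
    rewrite [leRHS]expr2; apply: le_mul_of_lt => // c d.
    move=> /spec_lt[a fa ac] /spec_lt[b gb bd].
    rewrite expr2; apply: le_trans (spec_le (rateM fa gb)) _.
    by rewrite ler_pM ?ltW //; [case: fa|case: gb].
  apply: le_spec => a fa; have a0 : 0 < a by case: fa.
  rewrite -[leRHS](sqr_sqrtr (ltW a0)) lerXn2r ?nnegrE ?sqrtr_ge0 //.
  exact/spec_le/rate_sqrt.
Qed.

End SpectralSeminorm.

(** * Multiplicative seminorms *)

Section MultiplicativeSeminorms.
Variables (R : realType) (A : comAlgType R[i]).
Implicit Types q : A -> R.

(** The seminorms [q] with [r * q g <= q (a * g)] form a class closed under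
    infima of chains and under localization at elements where they are
    positive; for positive [r] it contains the localization of [q0] at [a].
    The condition [r <= q a] alone would not survive localization at another
    element.  A minimal member is below all its own localizations, and this
    says that it is multiplicative. *)
Lemma exists_multiplicative_seminorm q0 (a : A) (r : R) :
  uniform_seminorm q0 -> 0 <= r -> r <= q0 a ->
  exists q, [/\ uniform_seminorm q, {morph q : f g / f * g} & r <= q a].
Proof.
move=> q0U r0 rq0.
pose P q := uniform_seminorm q /\ forall g, r * q g <= q (a * g).
have [q1 Pq1] : exists q, P q.
  have [rz|rp] := eqVneq r 0.
    by exists q0; split=> // g; rewrite rz mul0r usn_ge0.
  have a0 : 0 < q0 a by apply: lt_le_trans rq0; rewrite lt0r rp.
  exists (localized_seminorm q0 a); split; first exact: localized_uniform.
  move=> g; apply: le_trans (localizedM_ge q0U a0 g).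
  by rewrite ler_wpM2r // (usn_ge0 (localized_uniform q0U a0)).
pose T := {q | P q}.
pose le (p q : T) := `[< forall g, sval q g <= sval p g >].
have [||F Ftot|t tmin] := @ZL_preorder T (exist _ q1 Pq1) le.
- by move=> p; apply/asboolP => g.
- move=> p q s /asboolP pq /asboolP qs; apply/asboolP => g.
  exact: le_trans (qs g) (pq g).
- have [[p0 Fp0]|F0] := pselect (F !=set0); last first.
    by exists (exist _ q1 Pq1) => s Fs; case: F0; exists s.
  pose G := [set sval p | p in F]; pose I := fun g => inf [set q g | q in G].
  have GP q : G q -> P q by move=> [p _ <-]; exact: svalP.
  have IU : uniform_seminorm I.
    apply: chain_inf_uniform; first by exists (sval p0), p0.
      by move=> q /GP[].
    move=> _ _ [p Fp <-] [q Fq <-].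
    by have [/asboolP pq|/asboolP qp] := Ftot _ _ Fp Fq; [right|left].
  have G0 g : [set q g | q in G] !=set0.
    by exists (sval p0 g), (sval p0) => //; exists p0.
  have I_le p g : F p -> I g <= sval p g.
    move=> Fp; apply: ge_inf; last by exists (sval p) => //; exists p.
    by exists 0 => _ [q /GP[qU _] <-]; exact: usn_ge0.
  have PI : P I.
    split=> // g; apply: lb_le_inf => // _ [_ [p Fp <-] <-].
    apply: le_trans ((svalP p).2 g); rewrite ler_wpM2l //.
    exact: I_le.
  by exists (exist _ I PI) => p Fp; apply/asboolP => g; exact: I_le.
case: t tmin => q [qU qa] /= tmin.
have qM f g : q f * q g <= q (f * g).
  have [f0|fn0] := eqVneq (q f) 0; first by rewrite f0 mul0r usn_ge0.
  have f0 : 0 < q f by rewrite lt0r fn0 usn_ge0.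
  have PL : P (localized_seminorm q f).
    by split; [exact: localized_uniform|exact: localized_ge_mul].
  have /asboolP/(_ g) := tmin (exist _ _ PL) (asboolT (localized_le qU f0)).
  rewrite /= => /(ler_wpM2l (ltW f0))/le_trans; apply.
  apply: le_trans (localizedM_ge qU f0 g) _.
  exact: localized_le.
exists q; split=> //; last by have := qa 1; rewrite mulr1 (usn1 qU) mulr1.
by move=> f g; apply/eqP; rewrite eq_le qM (usnM qU).
Qed.

End MultiplicativeSeminorms.

(** * Topology of the complex plane *)

Section ComplexTopology.
Variable R : realType.

Lemma lipschitz_continuous (T : pseudoMetricNormedZmodType R[i]) (f : T -> R) :
  (forall x y, `|f x - f y| <= rnorm (x - y)) -> continuous f.
Proof.
move=> fL x; apply/cvgrPdist_lt => e e0.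
have e0' : 0 < real_complex R e by rewrite ltcR.
near=> y; apply: le_lt_trans (fL x y) _; rewrite -ltcR -rnormE.
near: y; exact: (@cvgr_dist_lt _ _ _ (nbhs x) _ id x).
Unshelve. all: end_near. Qed.

Lemma rnorm_continuous (V : normedModType R[i]) : continuous (@rnorm R V).
Proof.
apply: lipschitz_continuous => x y; rewrite ler_norml; apply/andP; split.
  rewrite lerNl opprB lerBlDr -(rnormN (x - y)) opprB.
  by apply: le_trans (rnormD _ _); rewrite subrK.
by rewrite lerBlDr; apply: le_trans (rnormD _ _); rewrite subrK.
Qed.

Lemma continuous_real_complex : continuous (real_complex R : R -> R[i]).
Proof.
move=> x; apply/cvgrPdist_lt => e e0.
have eE : e = real_complex R (rnorm e) by rewrite -rnormE ger0_norm // ltW.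
have e0' : 0 < rnorm e by rewrite -ltcR -eE.
near=> y; rewrite -rmorphB /= rnormE eE ltcR /rnorm.
rewrite normc_def /= expr0n addr0 sqrtr_sqr.
near: y; exact: (@cvgr_dist_lt _ _ _ (nbhs x) _ id x).
Unshelve. all: end_near. Qed.

Lemma normRe_le (z : R[i]) : `|complex.Re z| <= rnorm z.
Proof.
rewrite /rnorm normc_def /= -sqrtr_sqr ler_wsqrtr //.
by rewrite lerDl sqr_ge0.
Qed.

Lemma normIm_le (z : R[i]) : `|complex.Im z| <= rnorm z.
Proof.
rewrite /rnorm normc_def /= -sqrtr_sqr ler_wsqrtr //.
by rewrite lerDr sqr_ge0.
Qed.

(** A closed disc is closed in the image of a square of [R * R]. *)
Lemma compact_disc (M : R) : compact [set z : R[i] | rnorm z <= M].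
Proof.
pose f (p : R * R) : R[i] := real_complex R p.1 + 'i%C * real_complex R p.2.
apply: (@subclosed_compact _ _ [set f p | p in `[- M, M] `*` `[- M, M]]).
- apply: (@preimage_closed _ _ (@rnorm R R[i]) [set x | x <= M]).
    by move=> x _; exact: rnorm_continuous.
  exact: closed_le.
- apply: continuous_compact; last first.
    by apply: compact_setX; exact: segment_compact.
  apply: continuous_subspaceT => p.
  apply: cvgD.
    apply: continuous_comp; first exact: cvg_fst.
    exact: continuous_real_complex.
  apply: cvgMr; apply: (@continuous_comp _ _ _ snd (real_complex R)).
    exact: cvg_snd.
  exact: continuous_real_complex.
- move=> z /= zM; exists (complex.Re z, complex.Im z); last first.
    by rewrite /f /= -complexE.
  split; rewrite /= in_itv /= -ler_norml (le_trans _ zM) //.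
    exact: normRe_le.
  exact: normIm_le.
Qed.

End ComplexTopology.

(** * The Gelfand-Mazur theorem for multiplicative seminorms *)

Section GelfandMazur.
Variables (R : realType) (A : comAlgType R[i]).
Variables (q : A -> R) (qU : uniform_seminorm q).
Hypothesis qM : {morph q : f g / f * g}.

(** A monic polynomial is a product of factors [X - z], each of which is at
    least [c] at [f]. *)
Lemma monic_eval_ge (f : A) (c : R) (p : {poly R[i]}) : 0 <= c ->
  (forall z, c <= q (f - z%:A)) -> p \is monic ->
  c ^+ (size p).-1 <= q (horner_alg f p).
Proof.
move=> c0 H /monicP pm; have [rs prs] := closed_field_poly_normal p.
rewrite pm scale1r in prs; rewrite prs size_prod_XsubC /=.
elim: rs {p pm prs} => [|z rs IH]; first by rewrite big_nil rmorph1 (usn1 qU).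
rewrite big_cons rmorphM /= qM exprS ler_pM ?exprn_ge0 //.
by rewrite rmorphB /= horner_algX horner_algC.
Qed.

(** [f ^+ k.+1 - z ^+ k.+1] is [f - z] times a monic polynomial in [f] of degree
    [k], to which [monic_eval_ge] applies. *)
Lemma eval_sub_le (f : A) (m : R) (z : R[i]) (k : nat) : 0 < m ->
  (forall w, m <= q (f - w%:A)) ->
  q (f - z%:A) * m ^+ k <= q f ^+ k.+1 + rnorm z ^+ k.+1.
Proof.
move=> m0 H; pose p : {poly R[i]} := \sum_(i < k.+1) 'X^(k - i) * (z ^+ i)%:P.
have pE i : (i <= k)%N -> p`_i = z ^+ (k - i).
  move=> ik; rewrite coef_sum (bigD1 (inord (k - i))) //= coefMC coefXn.
  rewrite inordK ?ltnS ?leq_subr // subKn // eqxx mul1r big1 ?addr0 // => j.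
  move=> /eqP jn; rewrite coefMC coefXn; case: eqP => [ij|]; rewrite ?mul0r //.
  case: jn; apply/val_inj; rewrite /= inordK ?ltnS ?leq_subr // ij subKn //.
  by rewrite -ltnS.
have sp : size p = k.+1.
  apply/eqP; rewrite eqn_leq; apply/andP; split.
    apply/leq_sizeP => j kj; rewrite coef_sum big1 // => i _.
    rewrite coefMC coefXn; case: eqP => [ji|]; rewrite ?mul0r //.
    by move: kj; rewrite ji ltnNge leq_subr.
  by rewrite ltnNge; apply/negP => /leq_sizeP/(_ k (leqnn k));
    rewrite pE // subnn expr0 => /eqP; rewrite oner_eq0.
have pm : p \is monic by rewrite monicE lead_coefE sp /= pE // subnn expr0.
have := monic_eval_ge (ltW m0) H pm; rewrite sp /= => mp.
have fE : (f - z%:A) * horner_alg f p = f ^+ k.+1 - (z ^+ k.+1)%:A.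
  have zX i : (z ^+ i)%:A = z%:A ^+ i :> A by exact: (rmorphXn (in_alg A)).
  rewrite zX subrXX; congr (_ * _); rewrite rmorph_sum /=.
  apply: eq_bigr => i _.
  by rewrite rmorphM /= rmorphXn /= horner_algX horner_algC zX.
have q0 := usn_ge0 qU.
apply: (@le_trans _ _ (q (f - z%:A) * q (horner_alg f p))).
  by rewrite ler_wpM2l.
rewrite -qM fE; apply: le_trans (usnD qU _ _) _.
by rewrite (usnN qU) (usnX qU) (usnZ qU) (usn1 qU) mulr1 rnormX.
Qed.

(** Far from the origin the distance from [f] to a scalar exceeds [q f], the
    distance from [f] to [0]; so the minimum over a disc is global. *)
Lemma seminorm_dist_attained (f : A) :
  exists z, forall w, q (f - z%:A) <= q (f - w%:A).
Proof.
have q0 := usn_ge0 qU.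
have qA w : q w%:A = rnorm w by rewrite (usnZ qU) (usn1 qU) mulr1.
have tri a b : q (f - a%:A) <= rnorm (a - b) + q (f - b%:A).
  rewrite -(rnormN (a - b)) opprB -qA; apply: le_trans (usnD qU _ _).
  have -> // : (b - a)%:A + (f - b%:A) = f - a%:A :> A.
  by rewrite scalerBl; ring.
pose D := [set z : R[i] | rnorm z <= 2 * q f].
have D0 : D 0 by rewrite /D /= rnorm0 mulr_ge0.
have [||z zD zmin] := @compact_EVT_min R[i] R (fun z => q (f - z%:A)) D _
    (@compact_disc R _).
- by exists 0.
- apply: continuous_subspaceT; apply: lipschitz_continuous => a b.
  rewrite ler_norml; apply/andP; split; last by rewrite lerBlDr tri.
  by rewrite lerNl opprB lerBlDr -(rnormN (a - b)) opprB tri.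
exists z => w; have [wD|wD] := leP (rnorm w) (2 * q f).
  by apply: zmin; rewrite inE.
apply: (@le_trans _ _ (q f)).
  by have := zmin 0; rewrite scale0r subr0 => ->; rewrite // inE.
have : rnorm w <= q (f - w%:A) + q f.
  rewrite -qA -[q (f - _)](usnN qU) opprB; apply: le_trans (usnD qU _ _).
  by rewrite subrK.
by move: wD; lra.
Qed.

(** If the minimal distance [m] from [f] to the scalars were positive, then by
    [eval_sub_le] moving away from a nearest scalar by [c] with [|c| < m] would
    again give a nearest scalar, since [(|c| / m) ^ k] tends to [0].  Repeating
    this leads to nearest scalars that are arbitrarily far apart. *)
Lemma gelfand_mazur (f : A) : exists z, q (f - z%:A) = 0.
Proof.
have q0 := usn_ge0 qU.
have [z zmin] := seminorm_dist_attained f; exists z.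
apply/eqP/negPn/negP => m_neq0; set m := q (f - z%:A) in m_neq0.
have m0 : 0 < m by rewrite lt0r m_neq0 q0.
have mle w : m <= q (f - w%:A) by exact: zmin.
pose c : R[i] := real_complex R (m / 2).
have cE : rnorm c = m / 2 by rewrite rnorm_real // divr_ge0 // ltW.
have step w : q (f - w%:A) = m -> q (f - (w + c)%:A) = m.
  move=> wm; apply/eqP; rewrite eq_le mle andbT.
  rewrite scalerDl opprD addrA; set g := f - w%:A in wm *.
  have mg u : m <= q (g - u%:A).
    by rewrite /g -addrA -opprD -scalerDl mle.
  have m20 : 0 <= m / 2 by rewrite divr_ge0 // ltW.
  rewrite leNgt -subr_gt0; apply/negP; set x := _ - m => x0.
  have : m <= m / 2.
    apply: (@le_of_powers _ _ _ (m / 2 / x) 0) => // [|k]; first exact: ltW.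
    have := eval_sub_le c k m0 mg; rewrite wm cE expr0 mulr1.
    have -> : q (g - c%:A) = x + m by rewrite /x subrK.
    rewrite mulrDl -exprS [leRHS]addrC lerD2r exprS => H.
    by rewrite mulrAC ler_pdivlMr // mulrC.
  by move: m0; lra.
have stepn k : q (f - (z + c *+ k)%:A) = m.
  by elim: k => [|k IH]; rewrite ?mulr0n ?addr0 // mulrSr addrA step.
(* Two nearest scalars differ by at most [2 * m], while [5] steps of length
   [m / 2] lead further than that. *)
have := usnD qU (f - z%:A) (- (f - (z + c *+ 5)%:A)).
rewrite (usnN qU) stepn -/m.
have -> : f - z%:A - (f - (z + c *+ 5)%:A) = (c *+ 5)%:A :> A.
  by rewrite scalerDl; ring.
rewrite (usnZ qU) (usn1 qU) mulr1 -mulr_natr rnormM cE.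
rewrite /rnorm normr_nat -(rmorph_nat (real_complex R)) /=.
by move: m0; lra.
Qed.

End GelfandMazur.

(** * Characters of a commutative Banach algebra *)

Section Characters.
Variables (R : realType) (A : comBanachAlgType R[i]).

Lemma rnorm_ba1 : rnorm (1 : A) = 1.
Proof. by rewrite /rnorm ba_normr1. Qed.

Lemma rnorm_baM (f g : A) : rnorm (f * g) <= rnorm f * rnorm g.
Proof. by rewrite -lecR rmorphM /= -!rnormE ba_normrM. Qed.

(** The hypothesis says that [r] is at most the spectral radius of [a].  The
    character sends [f] to the unique scalar at distance zero from [f] for a
    multiplicative seminorm [q] with [r <= q a]; the kernel of [q] being an
    ideal, this is linear and multiplicative. *)
Lemma exists_character_ge (a : A) (r : R) : 0 <= r ->
  (forall m, r ^+ m <= rnorm (a ^+ m)) ->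
  exists2 phi, characters phi & r <= rnorm (phi a).
Proof.
move=> r0 ra.
have ND := @rnormD R A; have NZ := @rnormZ R A.
have sU := spectral_uniform rnorm_ba1 ND NZ rnorm_baM.
have rs := spectral_seminorm_ge rnorm_ba1 ND NZ rnorm_baM r0 ra.
have [q [qU qM rq]] := exists_multiplicative_seminorm sU r0 rs.
pose phi f := sval (cid (gelfand_mazur qU qM f)).
have phiP f : q (f - (phi f)%:A) = 0 by rewrite /phi; case: cid.
have q0 := usn_ge0 qU.
have phi_uniq f z : q (f - z%:A) = 0 -> phi f = z.
  move=> fz; apply/eqP; rewrite -subr_eq0; apply/eqP/rnorm_eq0.
  apply/eqP; rewrite eq_le rnorm_ge0 andbT.
  rewrite -[leLHS]mulr1 -(usn1 qU) -(usnZ qU).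
  have -> : (phi f - z)%:A = (f - z%:A) - (f - (phi f)%:A) :> A.
    by rewrite scalerBl; ring.
  by apply: le_trans (usnD qU _ _) _; rewrite (usnN qU) fz phiP addr0.
exists phi; last first.
  apply: le_trans rq _; have := usnD qU (a - (phi a)%:A) (phi a)%:A.
  by rewrite subrK phiP add0r (usnZ qU) (usn1 qU) mulr1.
have q_eq0 f : q f <= 0 -> q f = 0 by move=> f0; apply/eqP; rewrite eq_le f0 q0.
split.
- move=> k f g; apply/phi_uniq/q_eq0.
  have -> : k *: f + g - (k * phi f + phi g)%:A =
      k *: (f - (phi f)%:A) + (g - (phi g)%:A).
    by rewrite scalerDl scalerBr -scalerA; ring.
  by apply: le_trans (usnD qU _ _) _; rewrite (usnZ qU) !phiP mulr0 addr0.
- move=> f g; apply/phi_uniq/q_eq0.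
  have -> : f * g - (phi f * phi g)%:A =
      f * (g - (phi g)%:A) + phi g *: (f - (phi f)%:A).
    rewrite mulrBr scalerBr -scalerAr mulr1 scalerA [phi g * _]mulrC; ring.
  apply: le_trans (usnD qU _ _) _.
  by rewrite qM (usnZ qU) !phiP !mulr0 addr0.
- exists 1; suff -> : phi 1 = 1 by rewrite oner_eq0.
  by apply: phi_uniq; rewrite scale1r subrr (usn0 qU).
Qed.

(** The sum of the geometric series of ratio [c] is an inverse of [1 - c]. *)
Lemma neumann (c : A) : rnorm c < 1 -> exists b, b = 1 + c * b.
Proof.
move=> c1; set t := rnorm c in c1; have t0 : 0 <= t := rnorm_ge0 c.
have NX m : rnorm (c ^+ m) <= t ^+ m.
  elim: m => [|m IH]; first by rewrite !expr0 rnorm_ba1.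
  by rewrite !exprS; apply: le_trans (rnorm_baM _ _) _; rewrite ler_wpM2l.
have t1 : 0 < 1 - t by rewrite subr_gt0.
have tail a b : rnorm (\sum_(a <= k < b) c ^+ k) <= t ^+ a / (1 - t).
  have [ba|/ltnW ab] := leqP b a.
    by rewrite big_geq // rnorm0 divr_ge0 ?exprn_ge0 // ltW.
  rewrite ler_pdivlMr //.
  apply: (@le_trans _ _ ((\sum_(a <= k < b) t ^+ k) * (1 - t))).
    rewrite (ler_wpM2r (ltW t1)) //; apply: le_trans (rnorm_sum _ _ _) _.
    by apply: ler_sum => k _.
  have -> : (\sum_(a <= k < b) t ^+ k) * (1 - t) = t ^+ a - t ^+ b.
    have := telescope_sumr (fun k => t ^+ k) ab => tel.
    rewrite mulr_suml -[RHS]opprB -tel -sumrN.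
    by apply: eq_bigr => k _; rewrite exprS; ring.
  by rewrite gerBl exprn_ge0.
have cau : cauchy (series (fun k => c ^+ k) @ \oo).
  apply/cauchy_seriesP => e e0.
  have eE : e = real_complex R (rnorm e) by rewrite -rnormE ger0_norm // ltW.
  have e0' : 0 < rnorm e by rewrite -ltcR -eE.
  have [N _ HN] : \forall n \near \oo, t ^+ n < rnorm e * (1 - t).
    have := @cvg_expr R t; rewrite ger0_norm // => /(_ c1).
    move/cvgrPdist_lt/(_ (rnorm e * (1 - t)) (mulr_gt0 e0' t1)).
    apply: filterS => n; rewrite sub0r normrN; apply: le_lt_trans.
    exact: ler_norm.
  exists ([set n | (N <= n)%N], setT).
    by split; [exists N|exact: filterT].
  move=> [a b] /= [Na _]; rewrite rnormE eE ltcR.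
  by apply: le_lt_trans (tail a b) _; rewrite ltr_pdivrMr // HN.
have /cauchy_cvgP/cvg_ex[b sb] := cau.
exists b; apply/eqP; rewrite -subr_eq0; apply/eqP/rnorm_eq0/eqP.
rewrite eq_le rnorm_ge0 andbT; apply/ler_addgt0Pr => e e0; rewrite add0r.
have e20 : 0 < real_complex R (e / 2) by rewrite ltcR divr_gt0.
have [N _ HN] := (cvgrPdist_lt _ _).1 sb _ e20.
have bN n : (N <= n)%N -> rnorm (b - series (fun k => c ^+ k) n) <= e / 2.
  by move=> Nn; rewrite ltW // -ltcR -rnormE; exact: HN.
set s := series _ in bN.
have sS : s N.+1 = 1 + c * s N.
  rewrite /s /series /= big_nat_recl // expr0 mulr_sumr; congr (_ + _).
  by apply: eq_bigr => k _; rewrite exprS.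
have -> : b - (1 + c * b) = (b - s N.+1) - c * (b - s N) by rewrite sS; ring.
apply: le_trans (rnormD _ _) _; rewrite rnormN [leRHS]splitr lerD ?bN //.
apply: le_trans (rnorm_baM _ _) _; rewrite -[leRHS]mul1r.
by rewrite ler_pM ?rnorm_ge0 ?bN // ltW.
Qed.

(** Otherwise [a / phi a] has norm less than [1], and [1 - a / phi a] would be
    both invertible and in the kernel of [phi]. *)
Lemma character_le (phi : A -> R[i]) (a : A) :
  characters phi -> rnorm (phi a) <= rnorm a.
Proof.
move=> [phiS phiM [a0 phia0]]; rewrite leNgt; apply/negP => lt.
have phi1 : phi 1 = 1.
  by apply: (mulfI phia0); rewrite -phiM !mulr1.
have phiD f g : phi (f + g) = phi f + phi g.
  by have := phiS 1 f g; rewrite scale1r mul1r.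
have phi0 : phi 0 = 0.
  by apply: (@addrI _ (phi 0)); rewrite -phiD !addr0.
have phiZ k f : phi (k *: f) = k * phi f.
  by have := phiS k f 0; rewrite phi0 !addr0.
have pa0 : phi a != 0.
  by apply: contraTneq lt => ->; rewrite rnorm0 -leNgt rnorm_ge0.
have [|b bE] := @neumann ((phi a)^-1 *: a).
  rewrite rnormZ rnormV mulrC ltr_pdivrMr ?mul1r //.
  exact: le_lt_trans (rnorm_ge0 _) lt.
have := congr1 phi bE; rewrite phiD phiM phiZ phi1 mulVf // mul1r => /eqP.
by rewrite -subr_eq0 opprD addrCA subrr addr0 oppr_eq0 oner_eq0.
Qed.

End Characters.

(** * Polynomials on circled sets *)

Section Polynomials.
Variables (R : realType) (n : nat).

Local Notation C := R[i].
Local Notation msize p := (mpoly.mmeasure mpoly.mdeg p).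
Local Notation monomial v m := (\prod_(j < n) v j ^+ m j).

(** ['X^M - 1] splits and is separable, hence has [M] distinct roots. *)
Lemma prim_root_exists (M : nat) : (0 < M)%N ->
  exists w : C, M.-primitive_root w.
Proof.
move=> M0; pose p : {poly C} := 'X^M - 1.
have [r Dp] := closed_field_poly_normal p.
rewrite (monicP _) ?monicXnsubC // scale1r in Dp.
have rn1 : all M.-unity_root r.
  by apply/allP => z; rewrite -root_prod_XsubC -Dp.
have sz_r : (M < (size r).+1)%N.
  by rewrite -(size_prod_XsubC r id) -Dp size_XnsubC.
have [|z _ wz] := hasP (has_prim_root M0 rn1 _ sz_r); last by exists z.
by rewrite -separable_prod_XsubC -Dp separable_Xn_sub_1 // pnatr_eq0 -lt0n.
Qed.

Lemma prim_root_orthogonality (M : nat) (w : C) (a b : nat) :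
  M.-primitive_root w -> (a < M)%N -> (b < M)%N ->
  \sum_(k < M) (w ^+ a / w ^+ b) ^+ k = if a == b then M%:R else 0.
Proof.
move=> wM aM bM; have w0 : w != 0.
  apply: contra_eq_neq (prim_expr_order wM) => ->.
  by rewrite expr0n eqn0Ngt (leq_ltn_trans _ aM) //= eq_sym oner_eq0.
set x := _ / _; case: eqP => [ab|/eqP ab].
  have -> : x = 1 by rewrite /x ab divff // expf_neq0.
  by under eq_bigr do rewrite expr1n; rewrite sumr_const card_ord.
have x1 : x - 1 != 0.
  rewrite subr_eq0 /x -(inj_eq (mulIf (expf_neq0 b w0))) divfK ?expf_neq0 //.
  by rewrite mul1r (eq_prim_root_expr wM) !modn_small.
apply: (mulfI x1); rewrite mulr0 -subrX1.
have wb i : (w ^+ i) ^+ M = 1 by rewrite exprAC (prim_expr_order wM) expr1n.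
by rewrite /x expr_div_n !wb divr1 subrr.
Qed.

Lemma norm_prim_root (M : nat) (w : C) : (0 < M)%N ->
  M.-primitive_root w -> `|w| = 1.
Proof.
move=> M0 /prim_expr_order wM; apply/eqP.
by rewrite -(@pexpr_eq1 _ _ M) // -normrX wM normr1.
Qed.

(** Fourier inversion on the finite subgroup of the torus formed by the points
    whose coordinates are [M]-th roots of unity.  As [M] exceeds all exponents
    in [p], distinct monomials of [p] restrict to distinct, hence orthogonal,
    characters of this group, and a finite average replaces the integral over
    the torus. *)
Lemma cauchy_estimate (K : set 'rV[C]_n) (p : mpoly.mpoly n C) (B : R) :
  circled K -> (forall z, K z -> rnorm (mpoly.meval (z ord0) p) <= B) ->
  forall z m, K z -> m \in mpoly.msupp p ->
    rnorm (mpoly.mcoeff m p * monomial (z ord0) m) <= B.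
Proof.
move=> Kc KB z m0 Kz m0p; set M := msize p.
have mM m j : m \in mpoly.msupp p -> (m j < M)%N.
  move=> /mpoly.msize_mdeg_lt; apply: leq_ltn_trans.
  by rewrite mpoly.mdegE (bigD1 j) //= leq_addr.
have M0 : (0 < M)%N by apply: leq_ltn_trans (mpoly.msize_mdeg_lt m0p).
have [w wM] := prim_root_exists M0.
have w1 := norm_prim_root M0 wM.
pose al (k : {ffun 'I_n -> 'I_M}) : 'rV[C]_n := \row_j w ^+ k j.
pose zk k : 'rV[C]_n := \row_j (al k ord0 j * z ord0 j).
pose wt (k : {ffun 'I_n -> 'I_M}) : C :=
  \prod_(j < n) (w ^+ m0 j) ^- k j.
have Kzk k : K (zk k).
  by apply: Kc => // j; rewrite mxE normrX w1 expr1n.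
have wt1 k : rnorm (wt k) = 1.
  rewrite /rnorm normr_prod big1 // => j _.
  by rewrite normfV !normrX w1 !expr1n invr1.
have avg : \sum_k wt k * mpoly.meval (zk k ord0) p =
    (M ^ n)%:R * (mpoly.mcoeff m0 p * monomial (z ord0) m0).
  transitivity (\sum_(m <- mpoly.msupp p)
      mpoly.mcoeff m p * monomial (z ord0) m *
      \prod_(j < n) \sum_(k < M)
        (w ^+ m j / w ^+ m0 j) ^+ k).
    under eq_bigr => k _ do rewrite mpoly.mevalE mulr_sumr.
    rewrite exchange_big /=; apply: eq_bigr => m _.
    rewrite bigA_distr_bigA mulr_sumr; apply: eq_bigr => k _.
    rewrite mulrCA -!mulrA; congr (_ * _); rewrite -!big_split /=.
    apply: eq_bigr => j _; rewrite !mxE exprMn expr_div_n.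
    by rewrite [(w ^+ k j) ^+ _]exprAC [LHS]mulrC [X in X / _]mulrC -mulrA.
  rewrite (big_rem _ m0p) /= [X in _ + X]big1_seq ?addr0 => [|m /andP[_]].
    rewrite mulrC; congr (_ * _).
    under eq_bigr => j _ do rewrite (prim_root_orthogonality wM) ?mM // eqxx.
    by rewrite prodr_const card_ord natrX.
  rewrite mem_rem_uniq ?mpoly.msupp_uniq // inE => /andP[mm0 mp].
  have [j jm] : exists j, m j != m0 j.
    apply: contrapT => H; case/eqP: mm0; apply/mpoly.mnmP => j.
    by apply/eqP/negPn/negP => jm; apply: H; exists j.
  rewrite [X in _ * X](bigD1 j) //= (prim_root_orthogonality wM) ?mM //.
  by rewrite (negPf jm) mul0r mulr0.
have Mn0 : (0 : R) < (M ^ n)%:R by rewrite ltr0n expn_gt0 M0.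
rewrite -(ler_pM2l Mn0).
have -> : (M ^ n)%:R * rnorm (mpoly.mcoeff m0 p * monomial (z ord0) m0) =
    rnorm ((M ^ n)%:R * (mpoly.mcoeff m0 p * monomial (z ord0) m0)).
  rewrite [RHS]rnormM; congr (_ * _).
  by rewrite -(rmorph_nat (real_complex R)) rnorm_real.
rewrite -avg; apply: le_trans (rnorm_sum _ _ _) _.
apply: (@le_trans _ _ (\sum_(k : {ffun 'I_n -> 'I_M}) B)).
  by apply: ler_sum => k _; rewrite rnormM wt1 mul1r KB.
by rewrite sumr_const card_ffun !card_ord mulr_natl.
Qed.

(** All exponents of [p] are less than [msize p]. *)
Lemma size_msupp_le (p : mpoly.mpoly n C) :
  (size (mpoly.msupp p) <= msize p ^ n)%N.
Proof.
case E : (msize p) => [|M].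
  case F : (mpoly.msupp p) => [|m r] //.
  by have := @mpoly.msize_mdeg_lt _ _ p m; rewrite F E mem_head => /(_ isT).
pose f (m : mpoly.multinom n) : {ffun 'I_n -> 'I_M.+1} :=
  [ffun j => inord (m j)].
have f_inj : {in mpoly.msupp p &, injective f}.
  have lt m j : m \in mpoly.msupp p -> (m j < M.+1)%N.
    move=> /mpoly.msize_mdeg_lt; rewrite E; apply: leq_ltn_trans.
    by rewrite mpoly.mdegE (bigD1 j) //= leq_addr.
  move=> a b ap bp fab; apply/mpoly.mnmP => j.
  have /(congr1 val) := congr1 (fun g : {ffun _ -> _} => g j) fab.
  by rewrite !ffunE /= !inordK ?lt.
rewrite -(size_map f) -(card_uniqP _); last first.
  by rewrite map_inj_in_uniq ?mpoly.msupp_uniq.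
apply: leq_trans (max_card _) _.
by rewrite card_ffun !card_ord.
Qed.

Lemma msize_exp_le (p : mpoly.mpoly n C) (k : nat) :
  (msize (p ^+ k) <= (msize p).+2 * k.+1)%N.
Proof.
suff : (msize (p ^+ k) <= k * (msize p).+1 + 1)%N by nia.
elim: k => [|k IH]; first by rewrite expr0 mpoly.msize1.
rewrite exprS; apply: leq_trans (mpoly.msizeM_le _ _) _; nia.
Qed.

(** The triangle inequality and [cauchy_estimate] lose a factor equal to the
    number of terms of [p]; replacing [p] by its powers removes it. *)
Lemma circled_hull_le (K : set 'rV[C]_n) (s : 'rV[C]_n)
    (p : mpoly.mpoly n C) (B : R) :
  circled K -> 0 <= B ->
  (forall i : 'I_n -> nat, exists2 z, K z &
     rnorm (\prod_(j < n) s ord0 j ^+ i j) <=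
     rnorm (\prod_(j < n) z ord0 j ^+ i j)) ->
  (forall z, K z -> rnorm (mpoly.meval (z ord0) p) <= B) ->
  rnorm (mpoly.meval (s ord0) p) <= B.
Proof.
move=> Kc B0 Ks KB.
have term (q : mpoly.mpoly n C) (D : R) :
    (forall z, K z -> rnorm (mpoly.meval (z ord0) q) <= D) ->
    rnorm (mpoly.meval (s ord0) q) <= (size (mpoly.msupp q))%:R * D.
  move=> KD; rewrite mpoly.mevalE; apply: le_trans (rnorm_sum _ _ _) _.
  apply: (@le_trans _ _ (\sum_(m <- mpoly.msupp q) D)); last first.
    by rewrite big_const_seq count_predT iter_addr_0 mulr_natl.
  rewrite big_seq [leRHS]big_seq; apply: ler_sum => m mq.
  have [z Kz sz] := Ks m.
  apply: le_trans (cauchy_estimate Kc KD Kz mq).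
  by rewrite !rnormM ler_wpM2l ?rnorm_ge0.
apply: (@le_of_powers _ _ _ (((msize p).+2 ^ n)%:R) n) => // [|k].
  exact: rnorm_ge0.
have mX (v : 'rV[C]_n) :
    mpoly.meval (v ord0) (p ^+ k) = mpoly.meval (v ord0) p ^+ k.
  exact: rmorphXn.
rewrite -rnormX -mX; apply: le_trans (term _ (B ^+ k) _) _.
  by move=> z Kz; rewrite mX rnormX lerXn2r ?nnegrE ?rnorm_ge0 ?KB.
rewrite ler_wpM2r ?exprn_ge0 // -natrX -natrM ler_nat -expnMn.
apply: leq_trans (size_msupp_le _) _.
have leX e a b : (a <= b)%N -> (a ^ e <= b ^ e)%N.
  by case: e => // e ab; rewrite leq_exp2r.
exact/leX/msize_exp_le.
Qed.

End Polynomials.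

(** * Monomial hulls *)

Section MonomialHull.
Variables (R : realType) (n : nat).
Local Notation C := R[i].

Lemma continuous_monomial (T : topologicalType) (f : 'I_n -> T -> C)
    (i : 'I_n -> nat) :
  (forall j, continuous (f j)) ->
  continuous (fun t => \prod_(j < n) f j t ^+ i j).
Proof.
move=> fc.
have fX j k : continuous (fun t => f j t ^+ k).
  elim: k => [|k IH] s; first exact: cst_continuous.
  have -> : (fun t => f j t ^+ k.+1) = (fun t => f j t * f j t ^+ k).
    by apply/funext => t; rewrite exprS.
  by apply: cvgM; [exact: fc|exact: IH].
elim: (index_enum _) => [|j r IH] s.
  have -> : (fun t => \prod_(j <- [::]) f j t ^+ i j) = cst 1.
    by apply/funext => t; rewrite big_nil.
  exact: cst_continuous.
have -> : (fun t => \prod_(k <- j :: r) f k t ^+ i k) =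
    (fun t => f j t ^+ i j * \prod_(k <- r) f k t ^+ i k).
  by apply/funext => t; rewrite big_cons.
by apply: cvgM; [exact: fX|exact: IH].
Qed.

(** Among the monomials are the coordinates, which confine the set to a
    product of closed discs. *)
Lemma compact_monomial_bounded (c : ('I_n -> nat) -> R) :
  compact [set s : 'rV[C]_n |
    forall i, rnorm (\prod_(j < n) s ord0 j ^+ i j) <= c i].
Proof.
(* The exponents of the [j]-th coordinate. *)
pose e (j : 'I_n) (k : 'I_n) : nat := (k == j).
have disc (j : 'I_n) : compact [set z : C | rnorm z <= c (e j)].
  exact: compact_disc.
apply: subclosed_compact (rV_compact disc) _.
  rewrite (_ : [set s | _] = \bigcap_(i in setT)
      (fun s : 'rV[C]_n => rnorm (\prod_(j < n) s ord0 j ^+ i j)) @^-1`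
      [set x | x <= c i]).
    apply: closed_bigI => i _; apply: preimage_closed; last exact: closed_le.
    move=> s _; apply: continuous_comp; last exact: rnorm_continuous.
    by apply: continuous_monomial => j; exact: coord_continuous.
  by apply/seteqP; split=> s H i; [move=> _; exact: H|exact: (H i I)].
move=> s H j; have := H (e j).
rewrite (bigD1 j) //= /e eqxx expr1 big1 ?mulr1 // => k /negPf ->.
by rewrite expr0.
Qed.

Lemma polynomial_hull_monomial_le (S : set 'rV[C]_n) (s : 'rV[C]_n)
    (i : 'I_n -> nat) (c : R) :
  (forall z, S z -> rnorm (\prod_(j < n) z ord0 j ^+ i j) <= c) ->
  polynomial_hull S s -> rnorm (\prod_(j < n) s ord0 j ^+ i j) <= c.
Proof.
move=> Sc /(_ (mpoly.mpolyX _ (mpoly.Multinom [tuple i j | j < n]))) Hs.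
have E (v : 'rV[C]_n) :
    mpoly.meval (v ord0) (mpoly.mpolyX C (mpoly.Multinom [tuple i j | j < n])) =
    \prod_(j < n) v ord0 j ^+ i j.
  rewrite mpoly.mevalX; apply: eq_bigr => j _.
  by rewrite /mpoly.fun_of_multinom tnth_mktuple.
rewrite -lee_fin; move: Hs; rewrite E => /le_trans; apply.
by apply: ub_ereal_sup => _ [z Sz <-]; rewrite E lee_fin; exact: Sc.
Qed.

(** For circled sets the polynomial hull is determined by monomials.  The
    hypothesis for the zero exponent says that [K] is nonempty, so the supremum
    in the definition of the hull is finite or [+oo]. *)
Lemma circled_polynomial_hull (K : set 'rV[C]_n) (s : 'rV[C]_n) :
  circled K ->
  (forall i : 'I_n -> nat, exists2 z, K z &
     rnorm (\prod_(j < n) s ord0 j ^+ i j) <=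
     rnorm (\prod_(j < n) z ord0 j ^+ i j)) ->
  polynomial_hull K s.
Proof.
move=> Kc Ks p; pose absp (v : 'rV[C]_n) := rnorm (mpoly.meval (v ord0) p).
rewrite -[leLHS]/((absp s)%:E) -[leRHS]/(ereal_sup [set (absp z)%:E | z in K]).
have [z0 Kz0 _] := Ks (fun=> 0%N).
have up z : K z -> ((absp z)%:E <= ereal_sup [set (absp z)%:E | z in K])%E.
  by move=> Kz; apply: ereal_sup_ubound; exists z.
case E : (ereal_sup _) => [B| |]; last 2 first.
- by rewrite leey.
- by have := up _ Kz0; rewrite E leeNy_eq.
rewrite lee_fin; apply: circled_hull_le Kc _ Ks _.
  apply: le_trans (rnorm_ge0 (mpoly.meval (z0 ord0) p)) _.
  by rewrite -lee_fin -E; exact: up.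
by move=> z Kz; rewrite -lee_fin -E; exact: up.
Qed.

End MonomialHull.

Theorem theorem3p6 (R : realType) (n : nat) (hn : (1 <= n)%N)
    (A : comBanachAlgType R[i]) (x : 'I_n -> A) :
  is_smallest
    [set K : set 'rV[R[i]]_n |
      [/\ polynomially_convex K, circled K & joint_spectrum x `<=` K]]
    [set s : 'rV[R[i]]_n | forall i : 'I_n -> nat,
      `|\prod_(j < n) s ord0 j ^+ i j| <= `|\prod_(j < n) x j ^+ i j|].
Proof.
set S := (X in is_smallest _ X).
have SE : S = [set s : 'rV[R[i]]_n | forall i : 'I_n -> nat,
    rnorm (\prod_(j < n) s ord0 j ^+ i j) <= rnorm (\prod_(j < n) x j ^+ i j)].
  by apply/seteqP; split=> s H i; have := H i; rewrite rnorm_le.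
have char_prod (phi : A -> R[i]) : characters phi ->
    forall i : 'I_n -> nat,
    phi (\prod_(j < n) x j ^+ i j) = \prod_(j < n) phi (x j) ^+ i j.
  move=> [_ phiM [a0 phia0]] i.
  have phi1 : phi 1 = 1 by apply: (mulfI phia0); rewrite -phiM !mulr1.
  rewrite (big_morph phi phiM phi1); apply: eq_bigr => j _.
  by elim: (i j) => [|k IH]; rewrite ?expr0 // !exprS phiM IH.
split.
- split.
  + split; first by rewrite SE; exact: compact_monomial_bounded.
    apply/seteqP; split=> s.
      by move=> Ss p; apply: ereal_sup_ubound; exists s.
    move=> Hs; rewrite SE => i; apply: polynomial_hull_monomial_le Hs.
    by move=> z; rewrite SE; apply.
  + move=> s alpha; rewrite SE => Ss alpha1 i; apply: le_trans (Ss i).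
    under eq_bigr => j _ do rewrite mxE exprMn.
    rewrite big_split rnormM /= -[leRHS]mul1r ler_wpM2r ?rnorm_ge0 //.
    rewrite -(rnorm1 R) -rnorm_le normr_prod normr1 big1 // => j _.
    by rewrite normrX alpha1 expr1n.
  + move=> _ [phi phiC <-]; rewrite SE => i.
    under eq_bigr => j _ do rewrite mxE.
    by rewrite -char_prod //; exact: character_le.
- move=> K [[_ KE] Kc sK] s; rewrite SE => Ss; rewrite KE.
  apply: circled_polynomial_hull => // i.
  have [|phi phiC le] := @exists_character_ge R A (\prod_(j < n) x j ^+ i j)
    _ (rnorm_ge0 (\prod_(j < n) s ord0 j ^+ i j)).
    move=> m; rewrite -rnormX -!prodrXl.
    under eq_bigr => j _ do rewrite -exprM.
    under [X in _ <= rnorm X]eq_bigr => j _ do rewrite -exprM.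
    exact: (Ss (fun j => i j * m)%N).
  exists (\row_j phi (x j)); first by apply: sK; exists phi.
  under [X in _ <= rnorm X]eq_bigr => j _ do rewrite mxE.
  by rewrite -char_prod.
Qed.
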